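(* Let $\{\varepsilon_k\}_{k\in\mathbb{Z}}$ be i.i.d. random functions in $\mathcal{C}[0,1]$, let $\delta\in\mathcal{C}[0,1]^+$, and let $\beta:\mathcal{C}[0,1]^+\to\mathcal{C}[0,1]^+$ be a non-negative kernel operator, $\beta(x)(t)=\int\beta(t,s)x(s)\,ds$. Let $\alpha>0$ be such that $E\{H(\varepsilon_1^2)\}^\alpha<1$, where $H(\varepsilon_1^2)=\sup_{0\le t\le1}\int\beta(t,s)\varepsilon_1^2(s)\,ds$, and let $\{(y_k,\sigma_k^2)\}$ be the unique strictly stationary solution in $\mathcal{C}[0,1]$ of $y_k=\varepsilon_k\sigma_k$, $\sigma_k^2=\delta+\beta(y_{k-1}^2)$, $k\in\mathbb{Z}$. Then $$E\{\|\sigma_0^2\|_\infty\}^\alpha<\infty.$$ If moreover $E\{\|\sigma_0\|_\infty\}^\alpha<\infty$ and $E\{\|\varepsilon_0\|_\infty\}^\alpha<\infty$, then $$E\{\|y_0\|_\infty\}^\alpha<\infty.$$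
   Context: All integrals are over $[0,1]$. $\mathcal{C}[0,1]$ is the space of real continuous functions on $[0,1]$ with the sup-norm $\|x\|_\infty=\sup_{t\in[0,1]}|x(t)|$; $\mathcal{C}[0,1]^+$ is its subset of non-negative functions. Products, squares and square roots are pointwise; $\sigma_k\ge0$ is the pointwise square root of $\sigma_k^2$. The same symbol $\beta$ denotes the kernel and the operator. Under the condition $E\{H(\varepsilon_1^2)\}^\alpha<1$ the two equations have a unique strictly stationary solution with $y_k$ and $\sigma_k^2$ in $\mathcal{C}[0,1]$, and it satisfies $\sigma_k^2=g(\varepsilon_{k-1},\varepsilon_{k-2},\ldots)$ for a measurable functional $g:\mathcal{C}[0,1]^{\mathbb{N}}\to\mathcal{C}[0,1]$. *)

(* Defs.v *)
From HB Require Import structures.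
From mathcomp Require Import all_boot all_order all_algebra.
From mathcomp Require Import all_classical all_reals all_analysis.

Set Implicit Arguments.
Unset Strict Implicit.
Unset Printing Implicit Defensive.

Import Order.TTheory GRing.Theory Num.Theory.
Import numFieldNormedType.Exports.

Local Open Scope classical_set_scope.
Local Open Scope ring_scope.

Definition I01 (R : realType) : set R := `[0, 1].
Arguments I01 {R}.

Definition clamp01 (R : realType) (t : R) : R := Num.max 0 (Num.min 1 t).

(* A continuous function on [0, 1] is represented by its unique extension to  *)
(* R that is constant on ]-oo, 0] and on [1, +oo[ (see C01_ex and C01_ext):   *)
(* equality in C01 is equality on [0, 1], and the restrictions to [0, 1] of   *)
(* the elements of C01 are exactly the continuous functions on [0, 1].        *)
Definition cont01 (R : realType) : {pred R -> R} :=
  [pred f | `[< continuous f /\ forall t, f t = f (clamp01 t) >]].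

Record C01 (R : realType) := MkC01 {
  C01_fun :> R -> R;
  _ : C01_fun \in @cont01 R
}.

HB.instance Definition _ (R : realType) := [isSub for @C01_fun R].
HB.instance Definition _ (R : realType) := [Choice of C01 R by <:].

Section C01_algebra.
Variable R : realType.

Lemma clamp01_in (t : R) : I01 (clamp01 t).
Proof.
rewrite /I01 /clamp01 /= in_itv /= le_max lexx /=.
by rewrite ge_max ler01 /= ge_min lexx.
Qed.

Lemma clamp01_id (t : R) : I01 t -> clamp01 t = t.
Proof.
rewrite /I01 /clamp01 /= in_itv /= => /andP[t0 t1].
by rewrite (min_idPr t1) (max_idPr t0).
Qed.

Lemma clamp01_continuous : continuous (@clamp01 R).
Proof.
move=> t; apply: (@continuous_max _ _ (cst 0) (fun t : R => Num.min 1 t)).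
  exact: cvg_cst.
apply: (@continuous_min _ _ (cst 1) id); first exact: cvg_cst.
exact: cvg_id.
Qed.

Lemma cont01_subring : subring_closed (@cont01 R).
Proof.
split.
- by apply/asboolP; split=> // t; exact: cvg_cst.
- move=> f g /asboolP[cf ef] /asboolP[cg eg]; apply/asboolP; split.
    by move=> t; apply: (@cvgB _ R); [exact: cf|exact: cg].
  by move=> t; rewrite !fctE ef eg.
- move=> f g /asboolP[cf ef] /asboolP[cg eg]; apply/asboolP; split.
    by move=> t; apply: cvgM; [exact: cf|exact: cg].
  by move=> t; rewrite !fctE ef eg.
Qed.

HB.instance Definition _ :=
  GRing.isSubringClosed.Build (R -> R) (@cont01 R) cont01_subring.

HB.instance Definition _ := [SubChoice_isSubComNzRing of C01 R by <:].

Lemma cont01_scaler : scaler_closed (@cont01 R : {pred R -> R^o}).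
Proof.
move=> a f /asboolP[cf ef]; apply/asboolP; split.
  by move=> t; apply: (@cvgM _ _ _ _ (cst a)); [exact: cvg_cst|exact: cf].
by move=> t; rewrite !fctE ef.
Qed.

HB.instance Definition _ :=
  GRing.isScaleClosed.Build R (R -> R^o) (@cont01 R) cont01_scaler.

HB.instance Definition _ := [SubZmodule_isSubLmodule of C01 R by <:].

End C01_algebra.

Section C01_norm.
Variable R : realType.
Implicit Types x y : C01 R.

Lemma C01_continuous x : continuous x.
Proof. by case: x => f /= /asboolP[]. Qed.

Lemma C01_clamp x t : x t = x (clamp01 t).
Proof. by case: x => f /= /asboolP[]. Qed.

Lemma C01_ext x y : (forall t, I01 t -> x t = y t) -> x = y.
Proof.
move=> xy; apply/val_inj/funext => t /=.
by rewrite C01_clamp [RHS]C01_clamp; exact/xy/clamp01_in.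
Qed.

Lemma C01_ex (f : R -> R) : {within I01, continuous f} ->
  exists x : C01 R, forall t, I01 t -> x t = f t.
Proof.
move=> cf; have fP : f \o @clamp01 R \in @cont01 R.
  apply/asboolP; split => [|t /=]; last first.
    by rewrite (@clamp01_id _ (clamp01 t)) //; exact: clamp01_in.
  move=> t.
  have /subspace_continuousP /(_ _ (clamp01_in t)) cft := cf.
  apply: cvg_comp cft => U IU.
  have IUt : nbhs t (@clamp01 R @^-1` [set z | I01 z -> U z]).
    exact: (@clamp01_continuous R t _ IU).
  by apply: filterS IUt => s /= Us; apply: Us; exact: clamp01_in.
by exists (MkC01 fP) => t It /=; rewrite clamp01_id.
Qed.

Definition C01_norm x : R := sup [set `|x t| | t in I01].

Lemma C01_norm_has_sup x : has_sup [set `|x t| | t in I01].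
Proof.
split; first by exists `|x 0|, 0 => //; rewrite /I01 /= in_itv /= lexx ler01.
have cx : {within `[0, 1], continuous (fun t => `|x t|)}.
  apply: continuous_subspaceT => t.
  by apply: continuous_comp; [exact: C01_continuous|exact: norm_continuous].
have [c _ xc] := EVT_max (@ler01 R) cx.
by exists `|x c| => _ [t It <-]; exact: xc.
Qed.

Lemma C01_norm_ub x t : I01 t -> `|x t| <= C01_norm x.
Proof.
by move=> It; apply: ub_le_sup; [exact: (C01_norm_has_sup x).2|exists t].
Qed.

Lemma C01_norm_le x a : (forall t, I01 t -> `|x t| <= a) -> C01_norm x <= a.
Proof.
move=> xa; apply: ge_sup; first exact: (C01_norm_has_sup x).1.
by move=> _ [t It <-]; exact: xa.
Qed.

Lemma C01_normD x y : C01_norm (x + y) <= C01_norm x + C01_norm y.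
Proof.
apply: C01_norm_le => t It; apply: le_trans (ler_normD (x t) (y t)) _.
by apply: lerD; exact: C01_norm_ub.
Qed.

Lemma C01_normZ (a : R) x : C01_norm (a *: x) = `|a| * C01_norm x.
Proof.
have [->|a0] := eqVneq a 0.
  rewrite scale0r normr0 mul0r; apply/eqP; rewrite eq_le; apply/andP; split.
    by apply: C01_norm_le => t _; rewrite normr0.
  by apply: le_trans (C01_norm_ub 0 (clamp01_in 0)); exact: normr_ge0.
apply/eqP; rewrite eq_le; apply/andP; split.
  apply: C01_norm_le => t It; rewrite [leLHS](normrM a (x t)).
  by rewrite ler_wpM2l //; exact: C01_norm_ub.
rewrite -ler_pdivlMl ?normr_gt0 //; apply: C01_norm_le => t It.
rewrite ler_pdivlMl ?normr_gt0 // -normrM.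
exact: (@C01_norm_ub (a *: x)).
Qed.

Lemma C01_norm_eq0 x : C01_norm x = 0 -> x = 0.
Proof.
move=> x0; apply: C01_ext => t It; apply/eqP.
by rewrite -[_ == _]normr_le0 -x0; exact: C01_norm_ub.
Qed.

HB.instance Definition _ := @Lmodule_isNormed.Build R (C01 R)
  C01_norm C01_normD C01_normZ C01_norm_eq0.

HB.instance Definition _ := Measurable.copy (C01 R)
  (g_sigma_algebraType [set U : set (C01 R) | open U]).

End C01_norm.

Definition C01_nneg (R : realType) : set (C01 R) :=
  [set x | forall t, I01 t -> 0 <= x t].
Arguments C01_nneg {R}.

Lemma C01_sqrt_subproof (R : realType) (x : C01 R) :
  (fun t => Num.sqrt (x t)) \in @cont01 R.
Proof.
apply/asboolP; split=> [t|t]; last by rewrite C01_clamp.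
apply: continuous_comp; first exact: C01_continuous.
exact: sqrt_continuous.
Qed.

Definition C01_sqrt (R : realType) (x : C01 R) : C01 R :=
  MkC01 (C01_sqrt_subproof x).

(* The measurability of the sections of the kernel is what is needed for the  *)
(* integrals to make sense. The last equation is in the extended reals, so it *)
(* also says that the integral is finite. The values of beta outside of the   *)
(* cone of non-negative functions are irrelevant.                             *)
Definition nonneg_kernel_operator (R : realType)
    (b : R -> R -> R) (beta : C01 R -> C01 R) : Prop :=
  [/\ forall t s, I01 t -> I01 s -> 0 <= b t s,
      forall t, I01 t -> measurable_fun I01 (b t) &
      forall x, C01_nneg x -> C01_nneg (beta x) /\
        forall t, I01 t ->
          ((beta x t)%:E = \int[lebesgue_measure]_(s in I01) (b t s * x s)%:E)%E].

Definition kernel_sup (R : realType) (b : R -> R -> R) (x : C01 R) : R :=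
  sup [set (\int[lebesgue_measure]_(s in I01) (b t s * x s))%R | t in I01].

Section processes.
Context (d d' : measure_display) (Omega : measurableType d)
  (E : measurableType d') (R : realType) (P : probability Omega R).

Definition mutually_independent (I : eqType) (X : I -> {RV P >-> E}) : Prop :=
  forall (s : seq I) (A : I -> set E), uniq s -> (forall i, measurable (A i)) ->
    P (\big[setI/setT]_(i <- s) (X i @^-1` A i)) =
    (\prod_(i <- s) P (X i @^-1` A i))%E.

Definition identically_distributed (I : Type) (X : I -> {RV P >-> E}) : Prop :=
  forall (i j : I) (A : set E), measurable A ->
    distribution P (X i) A = distribution P (X j) A.

Definition iid (I : eqType) (X : I -> {RV P >-> E}) : Prop :=
  mutually_independent X /\ identically_distributed X.

Definition strictly_stationary (X : int -> Omega -> E) : Prop :=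
  forall (n : nat) (k : 'I_n -> int) (h : int) (A : set (n.-tuple E)),
    measurable A ->
    P [set w | A [tuple X (k i + h) w | i < n]] =
    P [set w | A [tuple X (k i) w | i < n]].

End processes.

Definition garch_solution (d : measure_display) (Omega : measurableType d)
    (R : realType) (P : probability Omega R) (eps : int -> Omega -> C01 R)
    (delta : C01 R) (beta : C01 R -> C01 R) (y sigma2 : int -> Omega -> C01 R) :
    Prop :=
  forall k : int, {ae P, forall w,
    y k w = eps k w * C01_sqrt (sigma2 k w) /\
    sigma2 k w = delta + beta (y (k - 1) w ^+ 2)}.

(* Main.v *)
Require Import Defs.
From mathcomp Require Import all_boot all_order all_algebra.
From mathcomp Require Import all_classical all_reals all_analysis.
From mathcomp Require Import measurable_realfun.
Import Order.TTheory GRing.Theory Num.Theory.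
Import numFieldNormedType.Exports.
Local Open Scope classical_set_scope.
Local Open Scope ring_scope.

Set Implicit Arguments.
Unset Strict Implicit.
Unset Printing Implicit Defensive.

(* Write X_n for the sup-norm of sigma_{-n}^2 and H_i for H(eps_{-i-1}^2). The
   equations give X_n <= |delta| + H_n X_{n+1} almost surely. Choose r with
   E H^alpha < r < 1, put q = r^(1/alpha) and
   Z = sum_j r^(-j) (H_0 ... H_{j-1})^alpha, which has a finite mean because the
   H_i are i.i.d. Then H_0 ... H_{j-1} <= q^j Z^(1/alpha), and unfolding the
   recursion n times gives
     X_0 <= |delta| / (1 - q) Z^(1/alpha) + q^n Z^(1/alpha) X_n.
   So where X_0 exceeds (|delta| / (1 - q) + 1) Z^(1/alpha), one has
   X_n > q^(-n) for every n; by stationarity this has probability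
   P(X_0 > q^(-n)), which tends to 0. Hence X_0^alpha <= C Z almost surely. For
   y_0 the same bound is multiplied by |eps_0|^alpha, which is independent of Z,
   so no causal representation of sigma_0 is needed. *)

(** * Expectations of products of functions of independent random elements *)

Section independence.
Local Open Scope ereal_scope.
Context {d d' : measure_display} {Omega : measurableType d}
  {E : measurableType d'} {R : realType} (P : probability Omega R).

Lemma measurable_RV_preimage (X : {RV P >-> E}) (A : set E) :
  measurable A -> measurable (X @^-1` A).
Proof.
by move=> mA; rewrite -[X in measurable X]setTI; exact: measurable_funPT.
Qed.

Lemma prod_indic (T : Type) (I : Type) (A : I -> set T) (s : seq I) (w : T) :
  (\prod_(i <- s) \1_(A i) w = \1_(\big[setI/setT]_(i <- s) A i) w :> R)%R.
Proof.
elim: s => [|i s IH]; first by rewrite !big_nil indicT.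
by rewrite !big_cons IH indicI.
Qed.

Import HBNNSimple.

(** Both sides are additive and positively homogeneous in [f] and pass to increasing limits, so a
    factorization known for indicators extends first to simple functions, then to all non-negative
    measurable ones. *)
Lemma integral_mul_comp_factor (G : Omega -> R) (X : {RV P >-> E}) (c : R) :
  measurable_fun [set: Omega] G -> (forall w, 0 <= G w)%R -> (0 <= c)%R ->
  (forall A, measurable A ->
    \int[P]_w (G w * \1_A (X w))%:E = c%:E * P (X @^-1` A)) ->
  forall f : E -> R, measurable_fun [set: E] f -> (forall x, 0 <= f x)%R ->
  \int[P]_w (G w * f (X w))%:E = c%:E * \int[P]_w (f (X w))%:E.
Proof.
move=> mG G0 c0 GA f mf f0.
have /measurable_EFinP mf' := mf.
pose h := nnsfun_approx measurableT mf'.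
have mhX n : measurable_fun [set: Omega] (fun w => h n (X w)).
  by apply: (measurableT_comp (f := h n)).
have hcvg w : (h n (X w))%:E @[n --> \oo] --> (f (X w))%:E.
  by apply: cvg_nnsfun_approx => // x _; rewrite lee_fin.
have hnd w : {homo (fun n => h n (X w)) : m n / (m <= n)%N >-> (m <= n)%R}.
  by move=> m n mn; exact/lefP/nd_nnsfun_approx.
have cvR : \int[P]_w (h n (X w))%:E @[n --> \oo] --> \int[P]_w (f (X w))%:E.
  rewrite (eq_integral (fun w => limn (fun n => (h n (X w))%:E))); last first.
    by move=> w _; apply/esym/cvg_lim.
  apply: (@cvg_monotone_convergence _ _ _ _ _ measurableT
    (fun n w => (h n (X w))%:E)) => //.
  - by move=> n; exact/measurable_EFinP.
  - by move=> n w _; rewrite lee_fin.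
  - by move=> w _ m n mn; rewrite lee_fin hnd.
have cvL : \int[P]_w (G w * h n (X w))%:E @[n --> \oo] -->
    \int[P]_w (G w * f (X w))%:E.
  rewrite (eq_integral (fun w => limn (fun n => (G w * h n (X w))%:E)));
    last first.
    move=> w _; apply/esym/cvg_lim => //.
    under eq_fun do rewrite EFinM.
    by rewrite EFinM; apply: cvgeZl.
  apply: (@cvg_monotone_convergence _ _ _ _ _ measurableT
    (fun n w => (G w * h n (X w))%:E)) => //.
  - by move=> n; apply/measurable_EFinP; exact: measurable_funM.
  - by move=> n w _; rewrite lee_fin mulr_ge0.
  - by move=> w _ m n mn; rewrite lee_fin ler_wpM2l// hnd.
apply/esym/(cvg_unique _ _ cvL) => //.
(* Both integrals are limits along the simple approximations [h n], so the identity is needed only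
   for each [h n]. *)
suff -> : (fun n => \int[P]_w (G w * h n (X w))%:E) =
          (fun n => c%:E * \int[P]_w (h n (X w))%:E) by exact: cvgeZl.
apply/funext => n.
have mI r :
    measurable_fun [set: Omega] (fun w => \1_(h n @^-1` [set r]) (X w) : R).
  rewrite -[X in measurable_fun _ X]/(\1_(X @^-1` (h n @^-1` [set r]))).
  by apply: measurable_indic; exact: measurable_RV_preimage.
have r0 r w : (0 <= r * \1_(h n @^-1` [set r]) (X w))%R.
  by have := nnfun_muleindic_ge0 (h n) r (X w); rewrite lee_fin.
(* A simple function is the finite sum of its values times the indicators of its level sets, where
   [GA] applies. *)
have hE w : (h n (X w))%:E =
    \sum_(r \in range (h n)) (r * \1_(h n @^-1` [set r]) (X w))%:E.
  by rewrite fimfunE -fsumEFin.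
under eq_integral => w _.
  rewrite EFinM hE ge0_mule_fsumr; last by move=> r; rewrite lee_fin.
  over.
rewrite ge0_integral_fsum//; last 2 first.
- move=> r; apply: emeasurable_funM; apply/measurable_EFinP => //.
  exact: measurable_funM.
- by move=> r w _; rewrite mule_ge0 ?lee_fin.
under [in RHS]eq_integral do rewrite hE.
rewrite ge0_integral_fsum//; last 2 first.
- by move=> r; apply/measurable_EFinP => //; exact: measurable_funM.
- by move=> r w _; rewrite lee_fin.
rewrite ge0_mule_fsumr; last first.
  by move=> r; apply: integral_ge0 => w _; rewrite lee_fin.
apply: eq_fsbigr => r /[!inE] -[x _ hxr].
have rge0 : (0 <= r)%R by rewrite -hxr.
under eq_integral do rewrite -EFinM mulrCA EFinM.
rewrite ge0_integralZl//; last 2 first.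
- by apply/measurable_EFinP; exact: measurable_funM.
- by move=> w _; rewrite lee_fin mulr_ge0.
under [in RHS]eq_integral do rewrite EFinM.
rewrite ge0_integralZl//; last exact/measurable_EFinP.
rewrite GA// muleCA; congr (_ * (_ * _)).
rewrite -[X in integral _ _ X]/(fun w =>
  (\1_(X @^-1` (h n @^-1` [set r])) w)%:E).
by rewrite integral_indic ?setIT//; exact: measurable_RV_preimage.
Qed.

(* Indicators are replaced by the functions [f i] one index at a time, so that
   no monotone class argument on product sigma-algebras is needed. *)
Let integral_prod_indic (I : eqType) (X : I -> {RV P >-> E}) (f : I -> E -> R)
    (m : I -> R) (s t : seq I) (A : I -> set E) :
  mutually_independent X ->
  (forall i, measurable_fun [set: E] (f i)) -> (forall i x, 0 <= f i x)%R ->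
  (forall i, i \in s -> \int[P]_w (f i (X i w))%:E = (m i)%:E) ->
  (forall i, measurable (A i)) -> uniq (s ++ t) ->
  \int[P]_w ((\prod_(i <- s) f i (X i w)) *
    \prod_(i <- t) \1_(A i) (X i w))%:E =
  (\prod_(i <- s) m i)%:E * \prod_(i <- t) P (X i @^-1` A i).
Proof.
move=> indX mf f0; elim: s t A => [|i s IH] t A fm mA ust.
  under eq_integral do rewrite big_nil mul1r.
  rewrite big_nil mul1e -indX//.
  under eq_integral => w _.
    rewrite -[in X in X%:E]/((\prod_(i <- t) \1_(X i @^-1` A i) w)%R).
    rewrite prod_indic.
    over.
  rewrite integral_indic// ?setIT//.
  elim: t {ust} => [|i t IHt]; first by rewrite big_nil.
  by rewrite big_cons; apply: measurableI => //; exact: measurable_RV_preimage.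
have m0 j : j \in i :: s -> (0 <= m j)%R.
  move=> js; rewrite -lee_fin -fm//.
  by apply: integral_ge0 => w _; rewrite lee_fin.
(* The factorization lemma takes a real constant, so the product of probabilities is first named as
   a real number. *)
have [p [p0 pE]] : exists p : R,
    (0 <= p)%R /\ \prod_(j <- t) P (X j @^-1` A j) = p%:E.
  elim: t {ust} => [|j t [p [p0 pE]]]; first by exists 1%R; rewrite big_nil.
  exists (fine (P (X j @^-1` A j)) * p)%R; split.
    by rewrite mulr_ge0// fine_ge0.
  rewrite big_cons pE EFinM fineK// fin_num_measure//.
  exact: measurable_RV_preimage.
under eq_integral do rewrite big_cons -mulrA mulrC.
rewrite (@integral_mul_comp_factor
  (fun w => (\prod_(j <- s) f j (X j w)) * \prod_(j <- t) \1_(A j) (X j w))%R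
  (X i) ((\prod_(j <- s) m j) * p)%R)//.
- by rewrite fm ?mem_head// big_cons pE -!EFinM mulrAC (mulrC (m i)).
- apply: measurable_funM; apply: measurable_prod => j _.
    exact: (measurableT_comp (mf j)).
  rewrite -[X in measurable_fun _ X]/(\1_(X j @^-1` A j)).
  by apply: measurable_indic; exact: measurable_RV_preimage.
- by move=> w; rewrite mulr_ge0//; apply: prodr_ge0.
- rewrite mulr_ge0// big_seq; apply: prodr_ge0 => j js.
  by apply: m0; rewrite in_cons js orbT.
- move=> B mB.
  have ni : i \notin t.
    by move: ust; rewrite cat_cons /= mem_cat negb_or => /andP[/andP[]].
  (* To test [f i] on the indicator of [B], the index [i] joins the indicator list with event [B];
     as [i] is not in [t], the other events keep their values and the induction hypothesis applies
     to [i :: t]. *)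
  pose A' j := if j == i then B else A j.
  have A'i : A' i = B by rewrite /A' eqxx.
  have A't j : j \in t -> A' j = A j.
    by move=> jt; rewrite /A'; case: eqP => // ji; move: ni; rewrite -ji jt.
  have := IH (i :: t) A'.
  rewrite big_cons A'i
    [in X in _ * (_ * X)](eq_big_seq (fun j => P (X j @^-1` A j))); last first.
    by move=> j jt; rewrite A't.
  rewrite pE EFinM -muleA (muleC p%:E) => <-.
  + apply: eq_integral => w _; congr (_%:E).
    rewrite big_cons A'i -mulrA; congr (_ * _)%R.
    by rewrite mulrC; congr (_ * _)%R; apply: eq_big_seq => j jt; rewrite A't.
  + by move=> j js; apply: fm; rewrite in_cons js orbT.
  + by move=> j; rewrite /A'; case: ifP.
  + have /permPl st := perm_catCA s [:: i] t.
    by rewrite (perm_uniq st).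
Qed.

Lemma integral_prod_indep (I : eqType) (X : I -> {RV P >-> E}) (f : I -> E -> R)
    (m : I -> R) (s : seq I) :
  mutually_independent X ->
  (forall i, measurable_fun [set: E] (f i)) -> (forall i x, 0 <= f i x)%R ->
  (forall i, i \in s -> \int[P]_w (f i (X i w))%:E = (m i)%:E) -> uniq s ->
  \int[P]_w (\prod_(i <- s) f i (X i w))%:E = (\prod_(i <- s) m i)%:E.
Proof.
move=> indX mf f0 fm us.
have := @integral_prod_indic _ X f m s [::] (fun=> setT) indX mf f0 fm.
rewrite cats0 big_nil mule1 => <- //.
by apply: eq_integral => w _; rewrite big_nil mulr1.
Qed.

Lemma identically_distributed_integral (I : Type) (X : I -> {RV P >-> E})
    (f : E -> R) (i j : I) :
  identically_distributed X -> measurable_fun [set: E] f ->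
  (forall x, 0 <= f x)%R ->
  \int[P]_w (f (X i w))%:E = \int[P]_w (f (X j w))%:E.
Proof.
move=> idX /measurable_EFinP mf f0.
rewrite -[LHS](ge0_integral_distribution (X i) mf)//.
rewrite -[RHS](ge0_integral_distribution (X j) mf)//.
by apply: eq_measure_integral => A mA _; exact: idX.
Qed.

(** The left inverse makes [u] injective, so [map u s] has no repetition, and it carries the events
    over to [I] as [A \o v]. This serves the time reversal [k] to [-k]. *)
Lemma mutually_independent_comp (I J : eqType) (u : J -> I) (v : I -> J)
    (X : I -> {RV P >-> E}) :
  cancel u v -> mutually_independent X -> mutually_independent (X \o u).
Proof.
move=> uK indX s A us mA.
have := indX (map u s) (A \o v).
rewrite !big_map => indXs.
have AE : A = A \o v \o u by apply/funext => j /=; rewrite uK.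
rewrite AE; apply: indXs => [|i].
  by rewrite map_inj_uniq//; exact: can_inj uK.
exact: mA.
Qed.

End independence.

(** * Order, norm and Borel measurability in the space of continuous functions *)

Section C01_complements.
Context {R : realType}.
Implicit Types (x z : C01 R).

Lemma C01_normE x : `|x| = C01_norm x. Proof. by []. Qed.

Lemma C01_sqr_nneg x : C01_nneg (x ^+ 2).
Proof. by move=> t _; exact: (@sqr_ge0 _ (x t)). Qed.

Lemma C01_measurable x : measurable_fun I01 x.
Proof.
apply: measurable_funTS; apply: continuous_measurable_fun.
exact: C01_continuous.
Qed.

Lemma C01_nneg_lin (a : R) x z : 0 <= a -> C01_nneg x -> C01_nneg z ->
  C01_nneg (a *: x + z).
Proof.
move=> a0 x0 z0 t It; apply: addr_ge0; last exact: z0.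
by apply: mulr_ge0 => //; exact: x0.
Qed.

Lemma C01_normM x z : `|x * z| <= `|x| * `|z|.
Proof.
apply: C01_norm_le => t It; rewrite [leLHS](normrM (x t) (z t)).
by apply: ler_pM => //; exact: C01_norm_ub.
Qed.

Lemma C01_nneg0 : C01_nneg (0 : C01 R).
Proof. by move=> t _; exact: lexx. Qed.

Lemma C01_cst1_nneg : C01_nneg (1 : C01 R).
Proof. by move=> t _; exact: ler01. Qed.

(** The sigma-algebra is generated by the open sets, and open half-lines generate that of [R]; their
    preimages are open. *)
Lemma C01_continuous_measurable (f : C01 R -> R) :
  continuous f -> measurable_fun [set: C01 R] f.
Proof.
move=> cf; apply: (measurability _ (RGenOInfty.measurableE R)).
move=> _ [_ [a ->]] <-; rewrite setTI; apply: sub_sigma_algebra => /=.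
by apply: open_comp => // x _; exact: cf.
Qed.

Lemma C01_norm_sqrt_le x :
  `|C01_sqrt x| <= Num.sqrt `|x|.
Proof.
apply: C01_norm_le => t It /=; rewrite ger0_norm ?sqrtr_ge0//.
by rewrite ler_wsqrtr//; apply: le_trans (C01_norm_ub x It); exact: ler_norm.
Qed.

Lemma C01_norm_measurable :
  measurable_fun [set: C01 R] (fun x : C01 R => `|x|).
Proof.
by apply: C01_continuous_measurable; exact: (@norm_continuous R (C01 R)).
Qed.

End C01_complements.

(** * The kernel operator on the non-negative cone and the norm inequality for the model *)

Section kernel.
Context {R : realType} (b : R -> R -> R) (beta : C01 R -> C01 R).
Hypothesis beta_kernel : nonneg_kernel_operator b beta.
Implicit Types (x z : C01 R) (t : R).

Let mI01 : measurable (I01 : set R).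
Proof. exact: measurable_itv. Qed.

Lemma kernel_mul_measurable x t :
  I01 t -> measurable_fun I01 (fun s => (b t s * x s)%:E).
Proof.
case: beta_kernel => _ mb _ It; apply/measurable_EFinP.
by apply: measurable_funM; [exact: mb|exact: C01_measurable].
Qed.

Lemma kernel_mul_ge0 x t s : C01_nneg x -> I01 t -> I01 s -> 0 <= b t s * x s.
Proof.
by case: beta_kernel => b0 _ _ x0 It Is; rewrite mulr_ge0 ?b0//; exact: x0.
Qed.

Lemma kernel_op_nneg x : C01_nneg x -> C01_nneg (beta x).
Proof. by case: beta_kernel => _ _ h /h[]. Qed.

Lemma kernel_opE x t : C01_nneg x -> I01 t ->
  (beta x t)%:E = (\int[lebesgue_measure]_(s in I01) (b t s * x s)%:E)%E.
Proof. by case: beta_kernel => _ _ h /h[_]; exact. Qed.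

Lemma kernel_op_le x z t : C01_nneg x -> C01_nneg z ->
  (forall s, I01 s -> x s <= z s) -> I01 t -> beta x t <= beta z t.
Proof.
move=> x0 z0 xz It; rewrite -lee_fin !kernel_opE//.
apply: ge0_le_integral => //.
- by move=> s Is; rewrite lee_fin; exact: kernel_mul_ge0.
- exact: kernel_mul_measurable.
- exact: kernel_mul_measurable.
- move=> s Is; rewrite lee_fin ler_wpM2l//; last exact: xz.
  by case: beta_kernel => b0 _ _; exact: b0.
Qed.

(** The integral formula for [beta] holds on the cone, so linearity is stated for non-negative
    combinations and comes from that of the integral. *)
Lemma kernel_op_lin (a : R) x z t : 0 <= a -> C01_nneg x -> C01_nneg z ->
  I01 t -> beta (a *: x + z) t = a * beta x t + beta z t.
Proof.
move=> a0 x0 z0 It; apply: EFin_inj.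
rewrite EFinD EFinM !kernel_opE//; last first.
  exact: C01_nneg_lin.
have <- : (\int[lebesgue_measure]_(s in I01) (a%:E * (b t s * x s)%:E) =
    a%:E * \int[lebesgue_measure]_(s in I01) (b t s * x s)%:E)%E.
  apply: ge0_integralZl => //; first exact: kernel_mul_measurable.
  by move=> s Is; rewrite lee_fin; exact: kernel_mul_ge0.
rewrite -ge0_integralD//.
- by apply: eq_integral => s _; rewrite -EFinM -EFinD mulrCA -mulrDr.
- by move=> s Is; rewrite mule_ge0// lee_fin; exact: kernel_mul_ge0.
- by apply: emeasurable_funM => //; exact: kernel_mul_measurable.
- by move=> s Is; rewrite lee_fin; exact: kernel_mul_ge0.
- exact: kernel_mul_measurable.
Qed.

Lemma kernel_op0 : beta 0 = 0.
Proof.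
apply: C01_ext => t It.
have := kernel_op_lin ler01 C01_nneg0 C01_nneg0 It.
by rewrite scaler0 addr0 mul1r -{1}[beta 0 t]addr0 => /addrI <-.
Qed.

(** The integrals are the non-negative values of [beta x]. Thus the functional H of the theorem
    becomes a norm, whose continuity can be studied. *)
Lemma kernel_sup_norm x : C01_nneg x -> kernel_sup b x = `|beta x|.
Proof.
move=> x0; rewrite C01_normE /kernel_sup /C01_norm; congr sup.
apply: eq_imagel => t It.
by rewrite /Rintegral -kernel_opE// ger0_norm//; exact: kernel_op_nneg.
Qed.

(** Monotonicity followed by linearity on the cone; the Lipschitz bound for squares and the
    recursion for the norms are both instances. *)
Lemma kernel_op_norm_le (a : R) x z u : 0 <= a -> C01_nneg x -> C01_nneg z ->
  C01_nneg u -> (forall s, I01 s -> u s <= a * x s + z s) ->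
  `|beta u| <= a * `|beta x| + `|beta z|.
Proof.
move=> a0 x0 z0 u0 uxz; apply: C01_norm_le => t It.
rewrite ger0_norm; last exact: kernel_op_nneg.
apply: (@le_trans _ _ (beta (a *: x + z) t)).
  by apply: kernel_op_le => //; exact: C01_nneg_lin.
rewrite kernel_op_lin//; apply: lerD.
  apply: ler_wpM2l => //.
  by apply: le_trans (C01_norm_ub _ It); exact: ler_norm.
by apply: le_trans (C01_norm_ub _ It); exact: ler_norm.
Qed.

Lemma kernel_op_sqr_lip x z :
  `|beta (x ^+ 2)| <= `|x ^+ 2 - z ^+ 2| * `|beta 1| + `|beta (z ^+ 2)|.
Proof.
apply: (kernel_op_norm_le (normr_ge0 _) C01_cst1_nneg);
  [exact: C01_sqr_nneg..|].
move=> s Is; rewrite -lerBlDr [leRHS]mulr1.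
by apply: le_trans (C01_norm_ub (x ^+ 2 - z ^+ 2) Is); exact: ler_norm.
Qed.

(** This gives the Borel measurability of H. The map is locally Lipschitz, since the norm of
    [x ^+ 2 - z ^+ 2] is controlled by that of [x - z]. *)
Lemma kernel_op_sqr_continuous : continuous (fun x => `|beta (x ^+ 2)|).
Proof.
move=> z.
pose g x := `|x - z| * (`|x - z| + 2 * `|z|) * `|beta 1|.
have xz2 x : `|x ^+ 2 - z ^+ 2| <= `|x - z| * (`|x - z| + 2 * `|z|).
  rewrite subr_sqr; apply: le_trans (C01_normM _ _) _; apply: ler_wpM2l => //.
  have -> : x + z = (x - z) + (z + z) by rewrite addrA subrK.
  apply: le_trans (ler_normD _ _) _; rewrite lerD2l mulr_natl mulr2n.
  exact: ler_normD.
have gxz x : `| `|beta (z ^+ 2)| - `|beta (x ^+ 2)| | <= g x.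
  have xz' : `|x ^+ 2 - z ^+ 2| * `|beta 1| <= g x by apply: ler_wpM2r.
  rewrite ler_norml lerBlDr lerBrDr addrC lerBlDr; apply/andP; split.
    by apply: le_trans (kernel_op_sqr_lip x z) _; rewrite addrC lerD2l.
  apply: le_trans (kernel_op_sqr_lip z x) _; rewrite lerD2r distrC.
  exact: xz'.
apply: (@cvgrPdist_lt _ _ _ _ (@nbhs_filter (C01 R) z) _ _).2 => e e0.
(* Within distance 1 of [z], [g x] is at most [m] times the distance; dividing [e] by [m + 1]
   instead of [m] covers [m = 0]. *)
pose m := (1 + 2 * `|z|) * `|beta 1|.
have m0 : 0 <= m by rewrite mulr_ge0// addr_ge0// mulr_ge0.
pose r := Num.min 1 (e / (m + 1)).
have r0 : 0 < r by rewrite lt_min ltr01 divr_gt0// ltr_wpDl.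
apply: (filterS _ (nbhsx_ballx z r r0)) => x.
rewrite -ball_normE /= distrC => xr.
apply: le_lt_trans (gxz x) _.
have [xr1 xre] : `|x - z| <= 1 /\ `|x - z| < e / (m + 1).
  by move: xr; rewrite lt_min => /andP[/ltW].
apply: (@le_lt_trans _ _ (`|x - z| * m)).
  by rewrite /g /m -mulrA ler_wpM2l// ler_wpM2r// lerD2r.
apply: (@le_lt_trans _ _ (e / (m + 1) * m)); first by rewrite ler_wpM2r// ltW.
by rewrite mulrAC ltr_pdivrMr ?ltr_wpDl// ltr_pM2l// ltrDl.
Qed.

(** Pointwise, the square of [e * C01_sqrt s] is at most the norm of [s] times [e ^+ 2], and [beta]
    preserves this bound. The comparison lemma is used with second function 0, whose image is 0. *)
Lemma garch_norm_recursion (delta e s : C01 R) :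
  `|delta + beta ((e * C01_sqrt s) ^+ 2)| <=
    `|delta| + `|beta (e ^+ 2)| * `|s|.
Proof.
apply: le_trans (ler_normD _ _) _; rewrite lerD2l [leRHS]mulrC.
have -> : `|s| * `|beta (e ^+ 2)| = `|s| * `|beta (e ^+ 2)| + `|beta 0|.
  by rewrite kernel_op0 normr0 addr0.
apply: (kernel_op_norm_le (normr_ge0 _) _ C01_nneg0);
  [exact: C01_sqr_nneg..|].
move=> u Iu; rewrite exprMn addr0.
rewrite -[leLHS]/((e u) ^+ 2 * (Num.sqrt (s u)) ^+ 2).
rewrite -[leRHS]/(`|s| * (e u) ^+ 2) mulrC ler_wpM2r ?sqr_ge0//.
apply: le_trans (C01_norm_ub s Iu).
(* At a point where [s] is negative, [Num.sqrt] takes its default value 0. *)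
have [su|su] := leP 0 (s u); first by rewrite sqr_sqrtr// ler_norm.
by rewrite ltr0_sqrtr// expr0n /= normr_ge0.
Qed.

End kernel.

(** * Deterministic bounds for an affine recursion *)

Section affine_recursion.
Context {R : realType}.
Implicit Types (D q : R).

Lemma geometric_sum_le q n : 0 <= q -> q < 1 ->
  \sum_(j < n) q ^+ j <= (1 - q)^-1.
Proof.
move=> q0 q1; have q1' : 0 < 1 - q by rewrite subr_gt0.
rewrite -[leRHS]mul1r ler_pdivlMr// mulrC -opprB mulNr -subrX1 opprB.
by rewrite gerBl exprn_ge0.
Qed.

Lemma affine_recursion_unfold D (X H : nat -> R) n :
  (forall k, 0 <= H k) -> (forall k, X k <= D + H k * X k.+1) ->
  X 0%N <= D * (\sum_(j < n) \prod_(i < j) H i) + \prod_(i < n) H i * X n.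
Proof.
move=> H0 XH; elim: n => [|n IH]; first by rewrite !big_ord0 mulr0 add0r mul1r.
apply: le_trans IH _; rewrite big_ord_recr/= mulrDr -addrA lerD2l.
rewrite [in leRHS]big_ord_recr/= -mulrA (mulrC D) -mulrDr ler_wpM2l//.
exact: prodr_ge0.
Qed.

(** After unfolding, the partial products are dominated by a geometric sequence, whose sum is at
    most [(1 - q)^-1]. *)
Lemma affine_recursion_le D q W (X H : nat -> R) n :
  0 <= D -> 0 <= q -> q < 1 -> 0 <= W -> 0 <= X n ->
  (forall k, 0 <= H k) -> (forall k, X k <= D + H k * X k.+1) ->
  (forall j, \prod_(i < j) H i <= q ^+ j * W) ->
  X 0%N <= D / (1 - q) * W + q ^+ n * W * X n.
Proof.
move=> D0 q0 q1 W0 Xn0 H0 XH HW.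
apply: le_trans (affine_recursion_unfold n H0 XH) _.
apply: lerD; last by rewrite ler_wpM2r.
rewrite -mulrA ler_wpM2l//.
apply: (@le_trans _ _ (\sum_(j < n) q ^+ j * W)); first exact: ler_sum.
by rewrite -mulr_suml ler_wpM2r// geometric_sum_le.
Qed.

End affine_recursion.

(** * The almost sure bound on the stationary recursion by a weighted series of products *)

Section perpetuity.
Local Open Scope ereal_scope.
Context {R : realType}.
Variables (alpha r : R).
Hypotheses (alpha_gt0 : (0 < alpha)%R) (r_gt0 : (0 < r)%R) (r_lt1 : (r < 1)%R).

(** This is Z of the overview when [h i] is the [alpha]-th power of H_i. It is extended real because
    it may diverge at some sample points. *)
Definition weighted_prod_series (h : nat -> R) : \bar R :=
  \sum_(0 <= j <oo) (r^-1 ^+ j * \prod_(i < j) h i)%:E.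

Lemma weighted_prod_ge0 (h : nat -> R) j : (forall i, 0 <= h i)%R ->
  (0 <= r^-1 ^+ j * \prod_(i < j) h i)%R.
Proof.
by move=> h0; rewrite mulr_ge0 ?exprn_ge0 ?invr_ge0 ?(ltW r_gt0)// prodr_ge0.
Qed.

Lemma weighted_prod_series_ge (h : nat -> R) j : (forall i, 0 <= h i)%R ->
  (r^-1 ^+ j * \prod_(i < j) h i)%:E <= weighted_prod_series h.
Proof.
move=> h0; apply: le_trans (nneseries_lim_ge j.+1 _); last first.
  by move=> n _ _; rewrite lee_fin weighted_prod_ge0.
rewrite big_nat_recr//= leeDr// sume_ge0// => i _.
by rewrite lee_fin weighted_prod_ge0.
Qed.

Lemma weighted_prod_series_ge1 (h : nat -> R) : (forall i, 0 <= h i)%R ->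
  1 <= weighted_prod_series h.
Proof.
move=> h0; have := weighted_prod_series_ge 0 h0.
by rewrite big_ord0 expr0 mulr1.
Qed.

Let q : R := (r `^ alpha^-1)%R.

Let q_ge0 : (0 <= q)%R. Proof. exact: powR_ge0. Qed.
Let q_gt0 : (0 < q)%R. Proof. exact: powR_gt0. Qed.

Let q_lt1 : (q < 1)%R.
Proof.
have <- : (1 `^ alpha^-1 = 1 :> R)%R by rewrite powR1.
apply: gt0_ltr_powR => //; rewrite ?nnegrE ?invr_gt0//.
exact: ltW.
Qed.

Let powRK (x : R) : (0 <= x)%R -> ((x `^ alpha) `^ alpha^-1 = x)%R.
Proof. by move=> x0; rewrite -powRrM divff ?gt_eqF// powRr1. Qed.

Let powRKV (x : R) : (0 <= x)%R -> ((x `^ alpha^-1) `^ alpha = x)%R.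
Proof. by move=> x0; rewrite -powRrM mulVf ?gt_eqF// powRr1. Qed.

(** The constant C of the overview; the summand 1 is the margin that the remainder of the unfolded
    recursion has to fill. *)
Definition perpetuity_cst (D : R) : R := ((D / (1 - q) + 1) `^ alpha)%R.

Lemma perpetuity_cst_gt0 D : (0 <= D)%R -> (0 < perpetuity_cst D)%R.
Proof.
move=> D0; apply: powR_gt0; apply: ltr_wpDl => //.
by apply: divr_ge0 => //; rewrite subr_ge0 ltW.
Qed.

Lemma affine_recursion_blowup D (X H : nat -> R) n :
  (0 <= D)%R -> (forall k, 0 <= X k)%R -> (forall k, 0 <= H k)%R ->
  (forall k, X k <= D + H k * X k.+1)%R ->
  (perpetuity_cst D)%:E * weighted_prod_series (fun i => H i `^ alpha)%R <
    (X 0%N `^ alpha)%R%:E ->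
  (q ^- n < X n)%R.
Proof.
move=> D0 X0 H0 XH.
have h0 i : (0 <= H i `^ alpha)%R by exact: powR_ge0.
have := weighted_prod_series_ge1 h0.
have := fun j => weighted_prod_series_ge j h0.
(* An infinite series contradicts the strict upper bound by a real number, and the lower bound 1
   excludes [-oo]. *)
case: (weighted_prod_series _) => [z zge z1|_ _|//]; last first.
  by rewrite gt0_muley ?lte_fin ?perpetuity_cst_gt0// ltNge leey.
rewrite lee_fin in z1; have z0 : (0 <= z)%R := le_trans ler01 z1.
pose W : R := (z `^ alpha^-1)%R.
have W0 : (0 < W)%R by apply: powR_gt0; exact: lt_le_trans z1.
(* One term of a non-negative series is at most its sum; taking the power [alpha^-1] turns
   [r ^+ j * z] into [q ^+ j * W]. *)
have HW j : (\prod_(i < j) H i <= q ^+ j * W)%R.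
  have P0 : (0 <= \prod_(i < j) H i)%R by exact: prodr_ge0.
  have := zge j; rewrite lee_fin exprVn ler_pdivrMl ?exprn_gt0// => hz.
  have PE : (\prod_(i < j) H i `^ alpha = (\prod_(i < j) H i) `^ alpha)%R.
    elim: j {P0 hz} => [|j IH]; first by rewrite !big_ord0 powR1.
    by rewrite !big_ord_recr/= IH powRM// prodr_ge0.
  have -> : (q ^+ j * W = (r ^+ j * z) `^ alpha^-1)%R.
    rewrite powRM ?exprn_ge0 ?(ltW r_gt0)//; congr (_ * _)%R.
    by rewrite -!powR_mulrn ?(ltW r_gt0)// powRAC.
  rewrite -(powRK P0); apply: ge0_ler_powR.
  - by rewrite invr_ge0 ltW.
  - by rewrite nnegrE powR_ge0.
  - by rewrite nnegrE mulr_ge0 ?exprn_ge0 ?(ltW r_gt0).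
  - by rewrite -PE.
have c0 : (0 <= D / (1 - q))%R by rewrite divr_ge0// subr_ge0 ltW.
rewrite -EFinM lte_fin => Xgt.
have {}Xgt : ((D / (1 - q) + 1) * W < X 0%N)%R.
  rewrite ltNge; apply/negP => XleW; move: Xgt; apply/negP; rewrite -leNgt.
  rewrite /perpetuity_cst -(powRKV z0) -powRM ?(ltW W0) ?addr_ge0//.
  apply: ge0_ler_powR => //; first exact: ltW.
    by rewrite nnegrE.
  by rewrite nnegrE mulr_ge0 ?addr_ge0// ltW.
have := lt_le_trans Xgt
  (affine_recursion_le D0 q_ge0 q_lt1 (ltW W0) (X0 n) H0 XH HW).
(* Cancelling the common term leaves [W] below [q ^+ n * W * X n]; division by [W] and [q ^+ n]
   concludes. *)
rewrite mulrDl mul1r ltrD2l mulrAC -ltr_pdivrMr// divff ?gt_eqF// => qX.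
by rewrite -[ltLHS]mul1r ltr_pdivrMr ?exprn_gt0// mulrC.
Qed.

Context {d : measure_display} {Omega : measurableType d}
  (P : probability Omega R).

(** The thresholds [q ^- n] increase to infinity, so the events decrease to the empty set and
    continuity from above applies. *)
Lemma probability_exceed_cvg0 (Y : Omega -> R) :
  measurable_fun [set: Omega] Y ->
  P [set w | q ^- n < Y w]%R @[n --> \oo] --> 0.
Proof.
move=> mY.
pose F n := [set w | q ^- n < Y w]%R.
have mF n : measurable (F n).
  have -> : F n = [set: Omega] `&` [set w | (q ^- n)%:E < (Y w)%:E].
    by rewrite setTI; apply/seteqP; split => w /=; rewrite lte_fin.
  apply: measurable_lte => //; exact/measurable_EFinP.
have F0 : \bigcap_n F n = set0.
  apply/seteqP; split => // w /= Fw.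
  have /cvgrPdist_lt/(_ _ ltr01)[N _ /(_ N (leqnn _))] :
      geometric (Y w) q @ \oo --> (0 : R)%R.
    by apply: cvg_geometric; rewrite ger0_norm.
  rewrite /= sub0r normrN => /(le_lt_trans (ler_norm _)).
  rewrite -ltr_pdivlMr ?exprn_gt0// mul1r => YN.
  by have := lt_trans YN (Fw N I); rewrite ltxx.
have := @nonincreasing_cvg_mu _ _ _ P F.
rewrite F0 measure0; apply => //.
- exact: le_lt_trans (probability_le1 _ (mF 0%N)) (ltry _).
- move=> m n mn; apply/subsetPset => w /=; apply: le_lt_trans.
  rewrite lef_pV2 ?posrE ?exprn_gt0//.
  by rewrite ler_wiXn2l// ltW.
Qed.

Lemma perpetuity_ae_le (D : R) (X H : nat -> Omega -> R) :
  (0 <= D)%R ->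
  (forall n, measurable_fun [set: Omega] (X n)) ->
  (forall n, measurable_fun [set: Omega] (H n)) ->
  (forall n w, 0 <= X n w)%R -> (forall n w, 0 <= H n w)%R ->
  (forall n, {ae P, forall w, X n w <= D + H n w * X n.+1 w})%R ->
  (forall n (a : R), P [set w | a < X n w]%R = P [set w | a < X 0%N w]%R) ->
  {ae P, forall w, (X 0%N w `^ alpha)%R%:E <=
    (perpetuity_cst D)%:E * weighted_prod_series (fun i => H i w `^ alpha)%R}.
Proof.
move=> D0 mX mH X0 H0 /ae_foralln[N [mN PN XHN]] Xst.
pose Z w := (perpetuity_cst D)%:E *
  weighted_prod_series (fun i => H i w `^ alpha)%R.
have mZ : measurable_fun [set: Omega] Z.
  apply: emeasurable_funM => //; apply: ge0_emeasurable_sum => [j w _ _|j _].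
    rewrite lee_fin (@weighted_prod_ge0 (fun i => H i w `^ alpha)%R)// => i.
    exact: powR_ge0.
  apply/measurable_EFinP; apply: measurable_funM => //.
  apply: measurable_prod => i _.
  exact: (measurableT_comp (measurable_powR alpha) (mH i)).
pose B := [set: Omega] `&` [set w | Z w < (X 0%N w `^ alpha)%R%:E].
have mB : measurable B.
  apply: measurable_lte => //; apply/measurable_EFinP.
  exact: (measurableT_comp (measurable_powR alpha) (mX 0%N)).
have mXn n (a : R) : measurable [set w | a < X n w]%R.
  have -> : [set w | a < X n w]%R =
      [set: Omega] `&` [set w | a%:E < (X n w)%:E].
    by rewrite setTI; apply/seteqP; split => w /=; rewrite lte_fin.
  apply: measurable_lte => //; exact/measurable_EFinP.
have PB n : P B <= P [set w | q ^- n < X 0%N w]%R.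
  (* Stationarity trades [X 0] for [X n]. The set [B] then lies in the event for [X n] together with
     [N], one null set off which the recursion holds for all indices. *)
  rewrite -(Xst n) -[leRHS]adde0 -PN.
  apply: le_trans (measureU2 _ _ _) => //; apply: le_measure; rewrite ?inE//.
    exact: measurableU.
  move=> w [_ /= Bw].
  have [Nw|nNw] := pselect (N w); [by right|left => /=].
  have XHw : (forall k, X k w <= D + H k w * X k.+1 w)%R.
    by apply: contrapT => /XHN.
  exact: (@affine_recursion_blowup D (X ^~ w) (H ^~ w) n).
have PB0 : P B = 0.
  apply/eqP; rewrite -measure_le0.
  apply: (cvge_to_ge (probability_exceed_cvg0 (mX 0%N))).
  by apply: nearW => n; exact: PB.
exists B; split => // w /= /negP; rewrite -ltNge => Bw.
by split.
Qed.

End perpetuity.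

(** * Finite mean of the weighted series *)

Section series_moment.
Local Open Scope ereal_scope.
Context {d d' : measure_display} {Omega : measurableType d}
  {E : measurableType d'} {R : realType} (P : probability Omega R).

(** By independence the [j]-th product has mean [M * rho ^+ j], so the weights leave a geometric
    series of ratio [rho / r < 1]. Index 0 is kept for the extra factor [g], and the series starts
    at index 1. *)
Lemma integral_weighted_prod_series_lty (X : nat -> {RV P >-> E})
    (g h : E -> R) (rho r : R) :
  mutually_independent X -> identically_distributed X ->
  measurable_fun [set: E] g -> measurable_fun [set: E] h ->
  (forall x, 0 <= g x)%R -> (forall x, 0 <= h x)%R ->
  \int[P]_w (g (X 0%N w))%:E < +oo ->
  \int[P]_w (h (X 1%N w))%:E = rho%:E ->
  (0 <= rho)%R -> (rho < r)%R ->
  \int[P]_w ((g (X 0%N w))%:E *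
    weighted_prod_series r (fun i => h (X i.+1 w))) < +oo.
Proof.
move=> indX idX mg mh g0 h0 gfin hrho rho0 rhor.
have r0 : (0 < r)%R := le_lt_trans rho0 rhor.
pose M := fine (\int[P]_w (g (X 0%N w))%:E).
have gM : \int[P]_w (g (X 0%N w))%:E = M%:E.
  rewrite /M fineK// ge0_fin_numE//.
  by apply: integral_ge0 => w _; rewrite lee_fin.
have M0 : (0 <= M)%R.
  by rewrite -lee_fin -gM; apply: integral_ge0 => w _; rewrite lee_fin.
pose a j w := (g (X 0%N w) * \prod_(i < j) h (X i.+1 w))%R.
have a0 j w : (0 <= a j w)%R by rewrite mulr_ge0// prodr_ge0.
have ma j : measurable_fun [set: Omega] (a j).
  apply: measurable_funM; first exact: (measurableT_comp mg).
  by apply: measurable_prod => i _; exact: (measurableT_comp mh).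
have aE j : \int[P]_w (a j w)%:E = (M * rho ^+ j)%:E.
  pose f (i : nat) := if i == 0%N then g else h.
  pose m (i : nat) := if i == 0%N then M else rho.
  transitivity (\int[P]_w (\prod_(i <- index_iota 0 j.+1) f i (X i w))%:E).
    by apply: eq_integral => w _; rewrite big_mkord big_ord_recl.
  rewrite (@integral_prod_indep _ _ _ _ _ _ _ X f m)//.
  - rewrite big_mkord big_ord_recl /= /m /=; congr ((_ * _)%:E)%R.
    by rewrite prodr_const card_ord.
  - by move=> [|i].
  - by move=> [|i].
  - move=> [|i] _; first exact: gM.
    by rewrite -hrho; exact: identically_distributed_integral.
  - exact: iota_uniq.
under eq_integral => w _.
  rewrite /weighted_prod_series -nneseriesZl; last first.
    move=> i _; rewrite lee_fin mulr_ge0 ?exprn_ge0 ?invr_ge0 ?(ltW r0)//.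
    exact: prodr_ge0.
  under eq_eseriesr do rewrite -EFinM mulrCA EFinM.
  over.
rewrite integral_nneseries//; last 2 first.
- by move=> j; apply: emeasurable_funM => //; apply/measurable_EFinP; exact: ma.
- move=> j w _; rewrite mule_ge0 ?lee_fin ?exprn_ge0 ?invr_ge0 ?(ltW r0)//.
  exact: (a0 j w).
have q0 : (0 <= rho / r)%R by rewrite divr_ge0// ltW.
have q1 : (rho / r < 1)%R by rewrite ltr_pdivrMr// mul1r.
under eq_eseriesr => j _.
  rewrite ge0_integralZl//; last 3 first.
  - by apply/measurable_EFinP; exact: ma.
  - by move=> w _; rewrite lee_fin; exact: (a0 j w).
  - by rewrite lee_fin exprn_ge0// invr_ge0 ltW.
  rewrite aE -EFinM mulrCA -exprMn mulrC (mulrC r^-1%R).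
  over.
apply: (@le_lt_trans _ _ (M / (1 - rho / r))%:E); last exact: ltry.
apply: lime_le.
  apply: is_cvg_nneseries => j _ _.
  by rewrite lee_fin mulr_ge0// exprn_ge0.
apply: nearW => n; rewrite big_mkord sumEFin lee_fin -mulr_suml [leLHS]mulrC.
by rewrite ler_wpM2l// geometric_sum_le.
Qed.

End series_moment.

(** A square root is at most 1 below 1 and at most its argument above 1. This bounds the moment of
    the volatility by that of its square. *)
Lemma powR_sqrt_le (R : realType) (x a : R) : 0 <= x -> 0 <= a ->
  Num.sqrt x `^ a <= 1 + x `^ a.
Proof.
move=> x0 a0; have [x1|/ltW x1] := leP x 1.
  apply: (@le_trans _ _ (1 `^ a)); last by rewrite powR1 lerDl powR_ge0.
  apply: ge0_ler_powR => //; rewrite ?nnegrE ?sqrtr_ge0//.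
  by rewrite -sqrtr1 ler_wsqrtr.
apply: (@le_trans _ _ (x `^ a)); last by rewrite lerDr.
apply: ge0_ler_powR => //; rewrite ?nnegrE ?sqrtr_ge0//.
rewrite -{2}(sqr_sqrtr x0) expr2 ler_peMl ?sqrtr_ge0//.
by rewrite -sqrtr1 ler_wsqrtr.
Qed.

(** * The two moment bounds for the stationary solution *)

Theorem proposition2p2 (R : realType) (d : measure_display)
    (Omega : measurableType d) (P : probability Omega R)
    (eps : int -> {RV P >-> C01 R}) (delta : C01 R)
    (b : R -> R -> R) (beta : C01 R -> C01 R) (alpha : R)
    (y sigma2 : int -> {RV P >-> C01 R})
    (eps_iid : iid eps)
    (delta_nneg : C01_nneg delta)
    (beta_kernel : nonneg_kernel_operator b beta)
    (alpha_gt0 : 0 < alpha)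
    (H_lt1 : ('E_P[(fun w => kernel_sup b (eps 1 w ^+ 2) `^ alpha)%R] < 1)%E)
    (solution : garch_solution P eps delta beta y sigma2)
    (stationary : strictly_stationary P (fun k w => (y k w, sigma2 k w))) :
  ('E_P[(fun w => `|sigma2 0 w| `^ alpha)%R] < +oo)%E /\
  (('E_P[(fun w => `|C01_sqrt (sigma2 0 w)| `^ alpha)%R] < +oo)%E ->
   ('E_P[(fun w => `|eps 0 w| `^ alpha)%R] < +oo)%E ->
   ('E_P[(fun w => `|y 0 w| `^ alpha)%R] < +oo)%E).
Proof.
case: eps_iid => eps_indep eps_id.
(* Time is reversed: [eta i.+1] is the innovation that enters H_i of the overview, and [eta 0] is
   [eps 0]. *)
pose eta (k : nat) : {RV P >-> C01 R} := eps (- k%:Z).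
have eta_indep : mutually_independent eta.
  apply: (@mutually_independent_comp _ _ _ _ _ _ _ _
    (fun k : nat => - k%:Z) absz) => //.
  by move=> k; rewrite abszN.
have eta_id : identically_distributed eta by move=> i j; exact: eps_id.
pose H (x : C01 R) : R := `|beta (x ^+ 2)|.
have mH : measurable_fun [set: C01 R] H.
  apply: C01_continuous_measurable.
  exact: (kernel_op_sqr_continuous beta_kernel).
pose h (x : C01 R) : R := H x `^ alpha.
have mh : measurable_fun [set: C01 R] h.
  exact: (measurableT_comp (measurable_powR alpha) mH).
have h0 x : 0 <= h x by exact: powR_ge0.
have [rho rhoE [rho0 rho1]] : exists2 rho : R,
    (\int[P]_w (h (eta 1%N w))%:E = rho%:E)%E & 0 <= rho /\ rho < 1.
  have : (\int[P]_w (h (eta 1%N w))%:E < 1)%E.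
    rewrite (identically_distributed_integral (X := eps) _ 1)//.
    move: H_lt1; rewrite unlock; apply: le_lt_trans.
    rewrite le_eqVlt; apply/orP; left; apply/eqP; apply: eq_integral => w _.
    by rewrite (kernel_sup_norm beta_kernel)//; exact: C01_sqr_nneg.
  have : (0 <= \int[P]_w (h (eta 1%N w))%:E)%E.
    by apply: integral_ge0 => w _; rewrite lee_fin.
  case: (\int[P]_w _)%E => [rho|//|//].
  by rewrite lee_fin lte_fin => rho0 rho1; exists rho.
(* Any number strictly between [rho] and 1 would do; the midpoint is chosen. *)
pose r := (rho + 1) / 2.
have rhor : rho < r by rewrite midf_lt.
have r1 : r < 1 by rewrite midf_lt.
have r0 : 0 < r := le_lt_trans rho0 rhor.
pose Z w := weighted_prod_series r (fun i => h (eta i.+1 w)).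
have Z1 w : (1 <= Z w)%E by apply: weighted_prod_series_ge1.
have Z0 w : (0 <= Z w)%E by exact: le_trans (Z1 w).
have mZ : measurable_fun [set: Omega] Z.
  apply: ge0_emeasurable_sum => [j w _ _|j _].
    by rewrite lee_fin (@weighted_prod_ge0 _ _ r0 (fun i => h (eta i.+1 w))).
  apply/measurable_EFinP; apply: measurable_funM => //.
  by apply: measurable_prod => i _; exact: (measurableT_comp mh).
pose C := perpetuity_cst alpha r `|delta|.
have C0 : 0 < C by exact: perpetuity_cst_gt0.
have mnorm (V : {RV P >-> C01 R}) :
    measurable_fun [set: Omega] (fun w => `|V w|).
  exact: (measurableT_comp (@C01_norm_measurable R)).
have sigmaZ : {ae P, forall w, ((`|sigma2 0 w| `^ alpha)%R%:E <= C%:E * Z w)%E}.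
  apply: (@perpetuity_ae_le _ _ _ alpha_gt0 r0 r1 _ _ P `|delta|
    (fun n w => `|sigma2 (- n%:Z) w|) (fun n w => H (eta n.+1 w))) => //.
  - by move=> n; exact: (measurableT_comp mH).
  - by move=> n w; exact: normr_ge0.
  (* The volatility equation at time [-n] is combined with the equation for [y] at time [-n - 1]. *)
  - move=> n; have s0 := solution (- n%:Z); have s1 := solution (- n.+1%:Z).
    apply: (filterS2 _ _ s1 s0) => w [yE _] [_ sE].
    have nE : - n%:Z - 1 = - n.+1%:Z by rewrite -addn1 PoszD opprD.
    by rewrite sE nE yE; exact: (garch_norm_recursion beta_kernel).
  - move=> n a.
    pose A : set (1.-tuple (C01 R * C01 R)) := [set t | a < `|(tnth t ord0).2|].
    have mA : measurable A.
      pose f (t : 1.-tuple (C01 R * C01 R)) : R := `|(tnth t ord0).2|.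
      have mf : measurable_fun [set: 1.-tuple (C01 R * C01 R)] f.
        apply: (measurableT_comp (@C01_norm_measurable R)).
        exact: (measurableT_comp measurable_snd (measurable_tnth ord0)).
      have -> : A = setT `&` f @^-1` `]a, +oo[.
        by rewrite setTI; apply/seteqP; split => t; rewrite /= in_itv/= andbT.
      exact: mf.
    (* Stationarity of the pair is read on a single time, through the event that its second
       component has norm above [a]. *)
    have := stationary 1%N (fun=> 0) (- n%:Z) A mA.
    rewrite /A /=.
    under eq_set do rewrite tnth_mktuple add0r.
    by under [X in _ = P X]eq_set do rewrite tnth_mktuple.
(* Domination scheme for both claims: [g] is the constant 1 for the volatility and the [alpha]-th
   power of the norm for [y 0]. *)
have lty (f : Omega -> R) (g : C01 R -> R) (K : R) :
    measurable_fun [set: Omega] f -> measurable_fun [set: C01 R] g ->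
    (forall w, 0 <= f w) -> (forall x, 0 <= g x) -> 0 <= K ->
    (\int[P]_w (g (eta 0%N w))%:E < +oo)%E ->
    {ae P, forall w, ((f w)%:E <= K%:E * ((g (eta 0%N w))%:E * Z w))%E} ->
    ('E_P[f] < +oo)%E.
  move=> mf mg f0 g0 K0 gfin fgZ; rewrite unlock.
  have mgZ :
      measurable_fun [set: Omega] (fun w => ((g (eta 0%N w))%:E * Z w)%E).
    apply: emeasurable_funM => //; apply/measurable_EFinP.
    exact: (measurableT_comp mg).
  apply: (@le_lt_trans _ _ (\int[P]_w (K%:E * ((g (eta 0%N w))%:E * Z w)))%E).
    apply: ae_ge0_le_integral => //.
    - by move=> w _; rewrite lee_fin.
    - exact/measurable_EFinP.
    - by move=> w _; rewrite !mule_ge0// lee_fin.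
    - exact: emeasurable_funM.
    - by apply: filterS fgZ => w.
  rewrite ge0_integralZl//; last by move=> w _; rewrite mule_ge0// lee_fin.
  have : (\int[P]_w ((g (eta 0%N w))%:E * Z w) < +oo)%E.
    exact: (integral_weighted_prod_series_lty eta_indep eta_id mg mh g0 h0
      gfin rhoE).
  have : (0 <= \int[P]_w ((g (eta 0%N w))%:E * Z w))%E.
    by apply: integral_ge0 => w _; rewrite mule_ge0// lee_fin.
  by case: (\int[P]_w _)%E => [l _ _|//|//]; rewrite -EFinM ltry.
split.
  apply: (lty _ (cst 1) C) => //; try exact: ltW.
  - exact: (measurableT_comp (measurable_powR alpha)).
  - rewrite -[X in (X < _)%E]/(\int[P]_w cst 1%E w)%E integral_cst//=.
    by rewrite probability_setT mul1e ltry.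
  - by apply: filterS sigmaZ => w; rewrite mul1e.
move=> _ epsfin.
apply: (lty _ (fun x => `|x| `^ alpha) (1 + C)) => //.
- exact: (measurableT_comp (measurable_powR alpha)).
- exact: (measurableT_comp (measurable_powR alpha) (@C01_norm_measurable R)).
- by rewrite addr_ge0// ltW.
- by move: epsfin; rewrite unlock.
have s0 := solution 0; apply: (filterS2 _ _ sigmaZ s0) => w sZ [yE _].
rewrite muleCA; apply: (@le_trans _ _
  (`|eps 0 w| `^ alpha * (1 + `|sigma2 0 w| `^ alpha))%R%:E).
  rewrite lee_fin yE; apply: (@le_trans _ _
    ((`|eps 0 w| * `|C01_sqrt (sigma2 0 w)|) `^ alpha)).
    apply: ge0_ler_powR; rewrite ?nnegrE ?mulr_ge0// ?(ltW alpha_gt0)//.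
    exact: C01_normM.
  rewrite powRM// ler_wpM2l ?powR_ge0//.
  apply: le_trans (powR_sqrt_le (normr_ge0 _) (ltW alpha_gt0)).
  apply: ge0_ler_powR; rewrite ?nnegrE ?sqrtr_ge0 ?(ltW alpha_gt0)//.
  exact: C01_norm_sqrt_le.
(* What remains is to bound 1 plus the [alpha]-th power of the norm of [sigma2 0] by [(1 + C) * Z]:
   the summand 1 is absorbed by [Z1], the other by [sigmaZ]. *)
rewrite EFinM; apply: lee_wpmul2l; first by rewrite lee_fin powR_ge0.
rewrite !EFinD ge0_muleDl ?lee_fin ?(ltW C0)// mul1e.
exact: leeD.
Qed.
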